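(* Let $(M,\mathrm{dist})$ be a compact metric space endowed with a finite Borel measure $\mu$ such that $\mu(U)>0$ for every nonempty open set $U\subset M$, and let $f\colon M\to M$ be a homeomorphism. Let $\Lambda\subset M$ be a transitive attractor of $f$ such that $f$ does not have the shadowing property on $\Lambda$. Then there exists $\varepsilon_0>0$ such that for every $y_0\in D(\Lambda)$ there exists $d_0>0$ such that for every $d\in(0,d_0)$, $$p(y_0,d,\varepsilon_0)=0,$$ i.e. a random $d$-pseudotrajectory starting at $y_0$ can be $\varepsilon_0$-shadowed with probability $0$.
   Context: For $a>0$ and $x\in M$, $B(a,x)$ denotes the open ball of radius $a$ centered at $x$. For $d>0$, a sequence $\{y_n\}_{n\ge 0}$ (or finite $\{y_n\}_{n=0}^N$) in $M$ is a $d$-pseudotrajectory if $\mathrm{dist}(y_{n+1},f(y_n))\le d$ for all admissible $n$. It is $\varepsilon$-shadowed if there is $x_0\in M$ with $\mathrm{dist}(y_n,f^n(x_0))\le\varepsilon$ for all admissible $n$. A compact set $\Lambda$ with $f(\Lambda)=\Lambda$ is an attractor if there exists an open neighborhood $U$ of $\Lambda$ with $f(U)\subset U$ and $\bigcap_{n\ge0}f^n(U)=\Lambda$. Its domain of attraction is $D(\Lambda)=\{x\in M: \mathrm{dist}(f^n(x),\Lambda)\to 0 \text{ as } n\to\infty\}$. $\Lambda$ is transitive if there exists $r\in\Lambda$ with $\Lambda=\overline{\{f^n(r):n\ge0\}}$. The map $f$ has the shadowing property on $\Lambda$ if for every $\varepsilon>0$ there exists $d>0$ such that for every $d$-pseudotrajectory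 $\{y_n\}_{n\ge0}\subset\Lambda$ there exists $x_0\in M$ (not necessarily in $\Lambda$) with $\mathrm{dist}(y_n,f^n(x_0))\le\varepsilon$ for all $n\ge0$. Random pseudotrajectories: for $y_0\in M$ and $d>0$, let $\Omega(y_0,d)$ be the set of all infinite $d$-pseudotrajectories starting at $y_0$, equipped with the probability measure $P^{y_0,d}$ of the Markov chain starting at $y_0$ with transition law: given $y_n$, the point $y_{n+1}$ is chosen uniformly in $B(d,f(y_n))$ with respect to $\mu$, i.e. $P(y_{n+1}\in A\mid y_n)=\mu(A\cap B(d,f(y_n)))/\mu(B(d,f(y_n)))$ for measurable $A\subset M$. For $\varepsilon>0$, $Sh(y_0,d,\varepsilon)\subset\Omega(y_0,d)$ is the (measurable) set of pseudotrajectories that can be $\varepsilon$-shadowed, and $p(y_0,d,\varepsilon)=P^{y_0,d}(Sh(y_0,d,\varepsilon))$. *)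

(* Defs.v *)
From mathcomp Require Import all_boot all_order all_algebra.
From mathcomp Require Import all_classical all_reals all_analysis.
Import Order.TTheory GRing.Theory Num.Theory.

Set Implicit Arguments.
Unset Strict Implicit.
Unset Printing Implicit Defensive.

Local Open Scope classical_set_scope.
Local Open Scope ring_scope.

Section MetricDefs.
Context {R : realType} {M : Type} (dist : M -> M -> R).

Definition is_metric : Prop :=
  [/\ forall x y, dist x y = 0 <-> x = y,
      forall x y, dist x y = dist y x &
      forall x y z, dist x z <= dist x y + dist y z].

Definition oball (a : R) (x : M) : set M := [set y | dist x y < a].

Definition dopen (U : set M) : Prop :=
  forall x, U x -> exists2 r, 0 < r & oball r x `<=` U.

Definition dcompact (K : set M) : Prop :=
  forall (I : Type) (U : I -> set M), (forall i, dopen (U i)) ->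
    K `<=` \bigcup_i U i ->
    exists2 J : set I, finite_set J & K `<=` \bigcup_(i in J) U i.

Definition dclosure (S : set M) : set M :=
  [set x | forall e, 0 < e -> exists2 s, S s & dist x s < e].

Definition dcontinuous (g : M -> M) : Prop :=
  forall x e, 0 < e -> exists2 del, 0 < del &
    forall y, dist x y < del -> dist (g x) (g y) < e.

Definition homeomorphism (f : M -> M) : Prop :=
  exists g : M -> M, [/\ cancel f g, cancel g f, dcontinuous f & dcontinuous g].

Definition attractor (f : M -> M) (L : set M) : Prop :=
  [/\ dcompact L, f @` L = L &
      exists U : set M, [/\ dopen U, L `<=` U, f @` U `<=` U &
                            \bigcap_(n in [set: nat]) (iter n f @` U) = L]].

Definition domain_of_attraction (f : M -> M) (L : set M) : set M :=
  [set x | forall e, 0 < e -> exists N : nat, forall n, (N <= n)%N ->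
             exists2 z, L z & dist (iter n f x) z < e].

Definition transitive_set (f : M -> M) (L : set M) : Prop :=
  exists2 r, L r & L = dclosure [set iter n f r | n in [set: nat]].

Definition pseudotraj (f : M -> M) (d : R) (y : nat -> M) : Prop :=
  forall n, dist (y n.+1) (f (y n)) <= d.

Definition shadowed (f : M -> M) (eps : R) (y : nat -> M) : Prop :=
  exists x0 : M, forall n, dist (y n) (iter n f x0) <= eps.

(* f has the shadowing property on L (shadowing point x0 anywhere in M) *)
Definition shadowing_on (f : M -> M) (L : set M) : Prop :=
  forall eps, 0 < eps -> exists2 d, 0 < d &
    forall y : nat -> M, (forall n, L (y n)) -> pseudotraj f d y -> shadowed f eps y.

End MetricDefs.

Section RandomDefs.
Context {R : realType} {disp : measure_display} {M : measurableType disp}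
  (dist : M -> M -> R) (mu : {measure set M -> \bar R}) (f : M -> M).

(* fdd d [:: A_0; ...; A_N] x = probability that the Markov chain started at x
   (transition: uniform w.r.t. mu on B(d, f y_n)) satisfies y_i \in A_i, i <= N. *)
Fixpoint fdd (d : R) (As : seq (set M)) (x : M) : \bar R :=
  match As with
  | [::] => 1%E
  | A :: As' =>
      ((\1_A x)%:E *
       ((fine (mu (oball dist d (f x))))^-1%:E *
        \int[mu]_(z in oball dist d (f x)) fdd d As' z))%E
  end.

(* (Om, P, Y) is a realization of the Markov chain of random d-pseudotrajectories
   starting at y0, i.e. the law of (Y n)_n is P^{y0,d} (characterized by its
   finite-dimensional distributions). *)
Definition random_pseudotraj (y0 : M) (d : R)
  {dO : measure_display} {Om : measurableType dO}
  (P : probability Om R) (Y : nat -> Om -> M) : Prop :=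
  (forall n, measurable_fun [set: Om] (Y n)) /\
  forall As : seq (set M), (forall i, (i < size As)%N -> measurable (nth set0 As i)) ->
    P [set w | forall i, (i < size As)%N -> nth set0 As i (Y i w)] = fdd d As y0.

Definition shadow_event {Om : Type} (y0 : M) (d eps : R) (Y : nat -> Om -> M) : set Om :=
  [set w | [/\ Y 0%N w = y0, pseudotraj dist f d (fun n => Y n w) &
              shadowed dist f eps (fun n => Y n w)]].

End RandomDefs.

(* Main.v *)
Require Import Defs.
From mathcomp Require Import all_boot all_order all_algebra.
From mathcomp Require Import all_classical all_reals all_analysis.
From mathcomp Require Import lra.

(* Fix [eps] for which shadowing fails on [L] and take [eps0 = eps / 2].  For every
   small [d] there is a finite [del]-pseudotrajectory [w_0, ..., w_N] in [L], with
   [del] much smaller than [d], that is not [eps]-shadowed.  The attractor is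
   asymptotically stable, so a [d]-pseudotrajectory from [y0] is eventually trapped
   near [L], and so is every exact orbit issued from it.  By transitivity each such
   orbit can be continued by a [del]-pseudotrajectory to [w_0, ..., w_N].  The random
   chain follows this continuation up to [2 del] within a bounded time with
   probability bounded below: each step asks it to hit a set of positive measure
   contained in the current ball.  Hence it almost surely does so at some time, and
   then it cannot be [eps / 2]-shadowed.  To stay within the finite-dimensional laws
   [fdd], the chain is observed through a finite measurable partition of [M] into
   cells of diameter less than [del]. *)

Set Implicit Arguments.
Unset Strict Implicit.
Unset Printing Implicit Defensive.

Import Order.TTheory GRing.Theory Num.Theory.
Import numFieldNormedType.Exports.
Local Open Scope classical_set_scope.
Local Open Scope ring_scope.

(** * Compactness arguments and pseudotrajectories in a compact metric space *)

Definition nbhd_of {R : realType} {M : Type} (dist : M -> M -> R) (e : R)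
  (L : set M) : set M := [set x | exists2 l, L l & dist x l < e].

Section MetricDynamics.
Context {R : realType} {M : choiceType} {dist : M -> M -> R}.
Implicit Types (d e r : R) (y : nat -> M) (f g : M -> M) (x z : M) (u v w : nat -> M).
Hypothesis dist_metric : is_metric dist.
Hypothesis M_compact : dcompact dist [set: M].

Lemma dist_self x : dist x x = 0.
Proof. by case: dist_metric => /(_ x x)[_ ->]. Qed.

Lemma distC x (y : M) : dist x y = dist y x.
Proof. by case: dist_metric. Qed.

Lemma dist_triangle (y : M) x z : dist x z <= dist x y + dist y z.
Proof. by case: dist_metric. Qed.

Lemma dist_ge0 x (y : M) : 0 <= dist x y.
Proof.
by have := dist_triangle y x x; rewrite dist_self (distC y x); lra.
Qed.

Lemma dopen_oball r x : dopen dist (oball dist r x).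
Proof.
move=> y; rewrite /oball/= => xy; exists (r - dist x y); first by lra.
by move=> z; rewrite /oball/=; have := dist_triangle y x z; lra.
Qed.

Lemma dopen_preimage f U : dcontinuous dist f -> dopen dist U ->
  dopen dist (f @^-1` U).
Proof.
move=> fc Uo x /Uo[e e0 xU]; have [r r0 fr] := fc x _ e0.
by exists r => // y xy; apply: xU; exact: fr.
Qed.

Lemma dcontinuous_iter f n : dcontinuous dist f -> dcontinuous dist (iter n f).
Proof.
move=> fc; elim: n => [|n IHn] x e e0; first by exists e.
have [r r0 fr] := fc (iter n f x) _ e0; have [s s0 ns] := IHn x _ r0.
by exists s => // y xy; apply: fr; exact: ns.
Qed.

(** Otherwise every point has a ball that [u] eventually leaves for good; past the largest leaving
    time of a finite subcover, [u] has nowhere to go. *)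
Lemma cluster_point (u : nat -> M) : exists x, forall e : R, 0 < e ->
  forall N, exists2 n, (N <= n)%N & dist x (u n) < e.
Proof.
apply: contrapT => /forallNP noclu.
have {}noclu (x : M) : exists eN : R * nat,
    0 < eN.1 /\ forall n, (eN.2 <= n)%N -> eN.1 <= dist x (u n).
  have /existsNP[e /not_implyP[e0 /existsNP[N far]]] := noclu x.
  exists (e, N); split=> //= n Nn; rewrite leNgt; apply/negP => xn.
  by apply: far; exists n.
have [g gP] := choice noclu.
have [||J Jfin cov] :=
  @M_compact M (fun x => oball dist (g x).1 x).
- by move=> x; exact: dopen_oball.
- by move=> x _; exists x => //; rewrite /oball/= dist_self; case: (gP x).
have [s sJ] : exists s : seq nat, forall x, J x -> (g x).2 \in s.
  have /finite_seqP[s sE] : finite_set [set (g x).2 | x in J].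
    exact: finite_image.
  exists s => x Jx.
  have : [set (g x).2 | x in J] (g x).2 by exists x.
  by rewrite sE.
have [x Jx] := cov (u (\max_(i <- s) i)) I.
rewrite /oball/= ltNge => /negP; apply; apply: (gP x).2.
by rewrite (big_rem _ (sJ _ Jx))/= leq_maxl.
Qed.

Lemma finite_net e : 0 < e -> exists s : seq M,
  forall x, exists2 z, z \in s & dist z x < e.
Proof.
move=> e0; have [||J /finite_seqP[s sJ] cov] := @M_compact M (oball dist e).
- by move=> x; exact: dopen_oball.
- by move=> x _; exists x => //; rewrite /oball/= dist_self.
by exists s => x; have [z] := cov x I; rewrite sJ; exists z.
Qed.

Lemma ltr_invSn e : 0 < e -> exists N, forall n, (N <= n)%N -> n.+1%:R^-1 < e.
Proof.
move=> e0; exists (Num.truncn e^-1) => n Nn.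
rewrite invf_plt ?posrE// ?ltr0n//.
by apply: (lt_le_trans (truncnS_gt _)); rewrite ler_nat ltnS.
Qed.

Lemma uniform_continuity g : dcontinuous dist g -> forall e : R, 0 < e ->
  exists2 r : R, 0 < r & forall x (y : M), dist x y < r -> dist (g x) (g y) < e.
Proof.
move=> gc e e0; apply: contrapT => /forall2NP H.
have {}H n : exists xy : M * M,
    dist xy.1 xy.2 < n.+1%:R^-1 /\ e <= dist (g xy.1) (g xy.2).
  have [/negP|] := H n.+1%:R^-1; first by rewrite invr_gt0 ltr0n.
  move=> /existsNP[x /existsNP[y /not_implyP[xy /negP gxy]]].
  by exists (x, y); split=> //; rewrite leNgt.
have [u uP] := choice H; have [x xclu] := cluster_point (fst \o u).
have e20 : 0 < e / 2 by lra.
have [r r0 gr] := gc x _ e20.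
have r20 : 0 < r / 2 by lra.
have [N NP] := ltr_invSn r20.
have [n /NP nr /= xn] := xclu _ r20 N.
have [un gun] := uP n; have {}un := lt_trans un nr.
have g1 : dist (g x) (g (u n).1) < e / 2 by apply: gr; lra.
have g2 : dist (g x) (g (u n).2) < e / 2.
  by apply: gr; have := dist_triangle (u n).1 x (u n).2; lra.
have := dist_triangle (g x) (g (u n).1) (g (u n).2).
by rewrite (distC _ (g x)); lra.
Qed.

(** The witness is a cluster point of the points that approximately shadow finite segments. The
    slack [1/(m+1)] leaves room for taking these points in finite nets. *)
Lemma shadowed_of_finite f y e : dcontinuous dist f ->
  (forall m, exists x, forall n, (n <= m)%N ->
     dist (y n) (iter n f x) <= e + m.+1%:R^-1) ->
  shadowed dist f e y.
Proof.
move=> fc /choice[u uP]; have [x xclu] := cluster_point u.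
exists x => n; rewrite leNgt; apply/negP => far.
set r := dist (y n) (iter n f x) - e; have r0 : 0 < r / 2 by rewrite /r; lra.
have [s s0 fs] := dcontinuous_iter n fc x r0.
have [N NP] := ltr_invSn r0.
have [m] := xclu s s0 (maxn N n); rewrite geq_max => /andP[/NP mr nm] /fs xm.
have := le_trans (dist_triangle (iter n f (u m)) (y n) (iter n f x))
  (lerD (uP m n nm) (lexx _)).
by rewrite (distC (iter n f (u m))); move: (m.+1%:R^-1) xm mr => i; rewrite /r; lra.
Qed.

Lemma iter_near f x T e : dcontinuous dist f -> 0 < e ->
  exists2 r : R, 0 < r & forall z, dist x z < r ->
    forall n, (n <= T)%N -> dist (iter n f x) (iter n f z) < e.
Proof.
move=> fc e0; elim: T => [|T [r r0 rP]].
  by exists e => // z xz n; rewrite leqn0 => /eqP->.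
have [s s0 sP] := dcontinuous_iter T.+1 fc x e0.
exists (Num.min r s) => [|z]; first by rewrite lt_min r0.
rewrite lt_min => /andP[xr xs] n; rewrite leq_eqVlt ltnS => /predU1P[->|].
  exact: sP.
exact: rP.
Qed.

(** Points ever closer to [L] but outside [U] would cluster at a point of the closure of [L], hence
    in the open set [U]. *)
Lemma nbhd_of_sub_open (L U : set M) : dclosure dist L `<=` L ->
  dopen dist U -> L `<=` U -> exists2 e : R, 0 < e & nbhd_of dist e L `<=` U.
Proof.
move=> Lcl Uo LU; apply: contrapT => /forall2NP H.
have {}H n : exists x, nbhd_of dist n.+1%:R^-1 L x /\ ~ U x.
  have [/negP|] := H n.+1%:R^-1; first by rewrite invr_gt0 ltr0n.
  by move=> /existsNP[x /not_implyP[xy NU]]; exists x.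
have [u uP] := choice H; have [x xclu] := cluster_point u.
have Ux : U x.
  apply/LU/Lcl => e e0; have e20 : 0 < e / 2 by lra.
  have [N NP] := ltr_invSn e20; have [n /NP ne xn] := xclu _ e20 N.
  have [[l Ll ul] _] := uP n; exists l => //.
  have {}ul := lt_trans ul ne.
  by have := dist_triangle (u n) x l; lra.
have [e e0 xU] := Uo _ Ux; have [n _ xn] := xclu _ e0 0%N.
by have [_] := uP n; apply; exact: xU.
Qed.

Lemma pseudotraj_shift f d y m : pseudotraj dist f d y ->
  pseudotraj dist f d (fun n => y (m + n)%N).
Proof. by move=> yP n; rewrite addnS. Qed.

Lemma pseudotraj_le f d e y : d <= e -> pseudotraj dist f d y ->
  pseudotraj dist f e y.
Proof. by move=> de yP n; exact: le_trans de. Qed.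

Lemma pseudotraj_orbit f d x : 0 <= d -> pseudotraj dist f d (fun n => iter n f x).
Proof. by move=> d0 n; rewrite iterS dist_self. Qed.

Lemma pseudotraj_cat f d u v m : pseudotraj dist f d u -> pseudotraj dist f d v ->
  dist (v 0%N) (f (u m)) <= d ->
  pseudotraj dist f d (fun n => if (n <= m)%N then u n else v (n - m.+1)%N).
Proof.
move=> uP vP vu n; case: ltngtP => [_|mn|->]; first exact: uP.
- by rewrite subSn.
- by rewrite subnn.
Qed.

Lemma pseudotraj_near_orbit f T e : dcontinuous dist f -> 0 < e ->
  exists2 d : R, 0 < d & forall y, pseudotraj dist f d y ->
    forall n, (n <= T)%N -> dist (y n) (iter n f (y 0%N)) < e.
Proof.
move=> fc; elim: T e => [|T IHT] e e0.
  by exists 1 => // y _ n; rewrite leqn0 => /eqP->; rewrite dist_self.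
have e20 : 0 < e / 2 by lra.
have [r r0 fr] := uniform_continuity fc e20.
have [d d0 dP] := IHT _ r0.
exists (Num.min d (e / 2)); first by rewrite lt_min d0.
move=> y yP [_|n nT]; first by rewrite dist_self.
have yd : pseudotraj dist f d y by apply: pseudotraj_le yP; rewrite ge_min lexx.
have ye : dist (y n.+1) (f (y n)) <= e / 2.
  by apply: le_trans (yP n) _; rewrite ge_min lexx orbT.
have := fr _ _ (dP y yd n nT).
by have := dist_triangle (f (y n)) (y n.+1) (iter n.+1 f (y 0%N)); rewrite iterS; lra.
Qed.

(** Applying [g] across one jump shows that [y m] is close to [g (y m.+1)]; iterating recovers the
    past of a pseudotrajectory from its present. *)
Lemma pseudotraj_backward f g j e : cancel f g -> dcontinuous dist g -> 0 < e ->
  exists2 d : R, 0 < d & forall y, pseudotraj dist f d y ->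
    forall m, dist (y m) (iter j g (y (m + j)%N)) < e.
Proof.
move=> fK gc; elim: j e => [|j IHj] e e0.
  by exists 1 => // y _ m; rewrite addn0 dist_self.
have e20 : 0 < e / 2 by lra.
have [r r0 gr] := uniform_continuity gc e20.
have [d d0 dP] := IHj _ r0.
have r20 : 0 < r / 2 by lra.
exists (Num.min d (r / 2)); first by rewrite lt_min d0.
move=> y yP m.
have yd : pseudotraj dist f d y by apply: pseudotraj_le yP; rewrite ge_min lexx.
have yr : dist (f (y m)) (y m.+1) < r.
  rewrite distC; apply: le_lt_trans (yP m) _.
  by rewrite gt_min; apply/orP; right; lra.
have := gr _ _ (dP y yd m.+1); have := gr _ _ yr; rewrite fK addSnnS.
by have := dist_triangle (g (y m.+1)) (y m) (iter j.+1 g (y (m + j.+1)%N)); rewrite iterS; lra.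
Qed.

(** * Stability of the attractor and connections through it *)

Section Attractor.
Variables (f g : M -> M) (L U : set M) (e1 : R).
Hypotheses (fK : cancel f g) (gK : cancel g f).
Hypotheses (fc : dcontinuous dist f) (gc : dcontinuous dist g).
Hypotheses (fL : f @` L = L)
  (UL : \bigcap_(n in [set: nat]) (iter n f @` U) = L).
Hypotheses (e1_gt0 : 0 < e1) (nbhdU : nbhd_of dist (e1 + e1) L `<=` U).

Lemma iter_cancel n : cancel (iter n g) (iter n f).
Proof. by elim: n => // n IHn x; rewrite iterSr iterS gK IHn. Qed.

(* A point all of whose preimages stay close to [L] lies in [L], so by compactness
   a long pseudotrajectory close to [L] must end very close to [L]. *)
Lemma contraction e : 0 < e -> exists N, exists2 d : R, 0 < d &
  forall y, pseudotraj dist f d y -> (forall n, (n <= N)%N -> nbhd_of dist e1 L (y n)) ->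
    nbhd_of dist e L (y N).
Proof.
move=> e0; apply: contrapT => /forallNP H.
have {}H k : exists y, [/\ pseudotraj dist f k.+1%:R^-1 y,
    forall n, (n <= k)%N -> nbhd_of dist e1 L (y n) & ~ nbhd_of dist e L (y k)].
  have /forall2NP/(_ k.+1%:R^-1)[/negP|] := H k.
    by rewrite invr_gt0 ltr0n.
  by move=> /existsNP[y /not_implyP[y1 /not_implyP[y2 y3]]]; exists y.
have [y yP] := choice H; have [z zclu] := cluster_point (fun k => y k k).
have Lz : L z.
  (* By [UL] it suffices that every [iter j g z] lies in [U]: it is within [e1 / 2 + e1 / 2] of some
     [y k (k - j)], itself within [e1] of [L]. *)
  rewrite -UL => j _; exists (iter j g z); last by rewrite iter_cancel.
  have e2 : 0 < e1 / 2 by rewrite divr_gt0.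
  have [r r0 gr] := dcontinuous_iter j gc z e2.
  have [d d0 dP] := pseudotraj_backward j fK gc e2.
  have [N NP] := ltr_invSn d0.
  have [k] := zclu _ r0 (maxn N j); rewrite geq_max => /andP[/NP kd jk] /gr zk.
  have [yk kK _] := yP k.
  have {}yk := dP _ (pseudotraj_le (ltW kd) yk) (k - j)%N.
  rewrite subnK// in yk.
  have [l Ll yl] := kK (k - j)%N (leq_subr _ _).
  apply: nbhdU; exists l => //.
  have := dist_triangle (iter j g (y k k)) (iter j g z) l.
  have := dist_triangle (y k (k - j)%N) (iter j g (y k k)) l.
  by rewrite (distC _ (y k (k - j)%N)); lra.
have [k _ zk] := zclu _ e0 0%N; have [_ _] := yP k; apply.
by exists z => //; rewrite distC.
Qed.

(** A window of [N + 1] terms near [L] slides forward: [contraction] puts its last term within [r]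
    of [L], so the image of that term is within [e1 / 2] of [L], and the jump costs at most
    [e1 / 2]. *)
Lemma trapped : exists N, exists2 d : R, 0 < d &
  forall y, pseudotraj dist f d y -> (forall n, (n <= N)%N -> nbhd_of dist e1 L (y n)) ->
    forall n, nbhd_of dist e1 L (y n).
Proof.
have e2 : 0 < e1 / 2 by rewrite divr_gt0.
have [r r0 fr] := uniform_continuity fc e2.
have [N [d d0 dP]] := contraction r0.
exists N, (Num.min d (e1 / 2)); first by rewrite lt_min d0.
move=> y yP yN.
have yd : pseudotraj dist f d y by apply: pseudotraj_le yP; rewrite ge_min lexx.
suff H m : forall n, (n <= m + N)%N -> nbhd_of dist e1 L (y n).
  by move=> n; apply: (H n); rewrite leq_addr.
elim: m => [//|m IHm] n; rewrite addSn leq_eqVlt ltnS => /predU1P[->{n}|]; last exact: IHm.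
have [|l Ll yl] := dP _ (pseudotraj_shift m yd).
  by move=> n nN; apply: IHm; rewrite leq_add2l.
exists (f l); first by rewrite -fL; exists l.
have ye : dist (y (m + N).+1) (f (y (m + N)%N)) <= e1 / 2.
  by apply: le_trans (yP _) _; rewrite ge_min lexx orbT.
by have := fr _ _ yl; have := dist_triangle (f (y (m + N)%N)) (y (m + N).+1) (f l); lra.
Qed.

(** The exact orbit of [y0] is [e1 / 2]-close to [L] from time [n0] on; following it up to time
    [n0 + N] supplies the window that [trapped] asks for. *)
Lemma eventually_trapped (y0 : M) : domain_of_attraction dist f L y0 ->
  exists n0, exists2 d0 : R, 0 < d0 &
    forall y, pseudotraj dist f d0 y -> y 0%N = y0 ->
      forall n, (n0 <= n)%N -> nbhd_of dist e1 L (y n).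
Proof.
have e2 : 0 < e1 / 2 by rewrite divr_gt0.
move=> /(_ _ e2)[n0 n0P]; have [N [d d0 dP]] := trapped.
have [s s0 sP] := pseudotraj_near_orbit (n0 + N) fc e2.
exists n0, (Num.min d s); first by rewrite lt_min d0.
move=> y yP y0E.
have yd : pseudotraj dist f d y by apply: pseudotraj_le yP; rewrite ge_min lexx.
have ys : pseudotraj dist f s y.
  by apply: pseudotraj_le yP; rewrite ge_min lexx orbT.
move=> n /subnKC<-; apply: (dP _ (pseudotraj_shift n0 yd)) => k kN.
have [l Ll xl] := n0P _ (leq_addr k n0).
have := sP _ ys (n0 + k)%N; rewrite leq_add2l y0E => /(_ kN) yx.
exists l => //; have := dist_triangle (iter (n0 + k) f y0) (y (n0 + k)%N) l; lra.
Qed.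

Hypothesis Ltrans : transitive_set dist f L.

(** Density of the orbit gives [N = 0]. Since [f] maps [L] onto itself, a later visit near [z] is
    the image of a visit near a preimage of [z]. *)
Lemma recurrent : exists x, forall z, L z -> forall e : R, 0 < e ->
  forall N, exists2 n, (N <= n)%N & dist z (iter n f x) < e.
Proof.
have [x _ LE] := Ltrans; exists x => w Lw e e0 N.
elim: N w Lw e e0 => [|N IHN] w Lw e e0.
  by move: Lw; rewrite LE => /(_ _ e0)[_ [n _ <-] wn]; exists n.
move: Lw; rewrite -fL => -[w' Lw' <-].
have [s s0 fs] := fc w' e0; have [n Nn wn] := IHN w' Lw' s s0.
by exists n.+1 => //; exact: fs.
Qed.

(** The orbit of [x] comes close to some [l] in [L], jumps there onto the recurrent orbit, follows
    it until just before a return near [w 0], and jumps onto [w]. *)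
Lemma connecting d x w : 0 < d -> (forall n, nbhd_of dist e1 L (iter n f x)) ->
  pseudotraj dist f d w -> L (w 0%N) ->
  exists T y, [/\ (0 < T)%N, pseudotraj dist f d y, y 0%N = x &
                  forall i, y (T + i)%N = w i].
Proof.
move=> d0 xK wP Lw.
have [s s0 fs] := uniform_continuity fc d0.
have s20 : 0 < s / 2 by lra.
have [m [d' d'0 contr]] := contraction s20.
have [l Ll xl] := contr _ (pseudotraj_orbit f x (ltW d'0)) (fun n _ => xK n).
have [r rP] := recurrent; have [k _ lk] := rP l Ll _ s20 0%N.
(* The bound [k.+2] makes the subtraction in [j] exact: [v j] is then [iter n.-1 f r], from which
   the jump to [w 0] is made. *)
have [n kn wn] := rP _ Lw d d0 k.+2.
pose v i := iter i f (iter k.+1 f r).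
pose zv i := if (i <= m)%N then iter i f x else v (i - m.+1)%N.
have zvP : pseudotraj dist f d zv.
  apply: pseudotraj_cat; try exact/pseudotraj_orbit/ltW.
  apply/ltW/fs; rewrite distC.
  by have := dist_triangle l (iter m f x) (iter k f r); lra.
pose j := (n - k.+2)%N.
exists (m.+1 + j).+1, (fun i => if (i <= m.+1 + j)%N then zv i
                                else w (i - (m.+1 + j).+1)%N).
split=> //.
- apply: pseudotraj_cat => //.
  rewrite /zv leqNgt ltnS leq_addr/= addKn /v -iterS -iterD.
  by rewrite addSnnS /j subnK// ltW.
- by move=> i; rewrite leqNgt leq_addr/= addKn.
Qed.

End Attractor.

End MetricDynamics.

(* No measurability is required: [fdd d As] is not obviously measurable in its
   starting point, and only lower bounds on its integrals are needed. *)
Section NonnegIntegral.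
Context {R : realType} {disp : measure_display} {T : measurableType disp}
  (mu : {measure set T -> \bar R}) (D : set T).
Implicit Types F G : T -> \bar R.
Local Open Scope ereal_scope.
Import HBNNSimple.

Lemma ge0_le_integral_nonmeasurable F G : (forall x, D x -> 0 <= F x) ->
  (forall x, D x -> F x <= G x) ->
  \int[mu]_(x in D) F x <= \int[mu]_(x in D) G x.
Proof.
move=> F0 FG; have G0 x : D x -> 0 <= G x.
  by move=> Dx; apply: le_trans (FG _ Dx); exact: F0.
rewrite !ge0_integralE//; apply: ge_ereal_sup => _ [h /= hF <-].
apply: ereal_sup_ubound; exists h => //= x; apply: le_trans (hF x) _.
by rewrite /patch; case: ifPn => // /set_mem; exact: FG.
Qed.

(** For [c > 0], scaling by [c] sends simple functions below [F] to simple functions below [c F]. *)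
Lemma ge0_integralZ_ge F (c : R) : (0 <= c)%R -> (forall x, D x -> 0 <= F x) ->
  c%:E * \int[mu]_(x in D) F x <= \int[mu]_(x in D) (c%:E * F x).
Proof.
rewrite le_eqVlt => /predU1P[<- F0|c0 F0].
  by rewrite mul0e; apply: integral_ge0 => x Dx; rewrite mul0e.
have cF0 x : D x -> 0 <= c%:E * F x.
  by move=> Dx; rewrite mule_ge0// ?F0// lee_fin ltW.
rewrite -lee_pdivlMl// !ge0_integralE//.
apply: ge_ereal_sup => _ [h /= hF <-].
rewrite lee_pdivlMl// -sintegralrM.
apply: ereal_sup_ubound; exists (scale_nnsfun h (ltW c0)) => //= x.
move: (hF x); rewrite /patch; case: ifPn => _ hFx.
  by rewrite EFinM lee_pmul2l.
have /eqP -> : h x == 0%R by rewrite eq_le fun_ge0 andbT -lee_fin.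
by rewrite mulr0.
Qed.

End NonnegIntegral.

(** * Lower bounds on the finite-dimensional laws of the chain *)

Section FiniteDimensionalLaws.
Context {R : realType} {disp : measure_display} {M : measurableType disp}
  (dist : M -> M -> R) (mu : {measure set M -> \bar R}) (f : M -> M) (d : R).
Hypothesis mu_fin : (mu [set: M] < +oo)%E.
Hypothesis ball_meas : forall x, measurable (oball dist d x).
Hypothesis ball_pos : forall x, (0 < mu (oball dist d x))%E.
Implicit Types (F G : M -> \bar R) (A B : set M) (As Bs : seq (set M)) (x y : M).
Local Open Scope ereal_scope.

(** The transition operator of the chain: the mean of [F] after one step from [x]. *)
Definition ball_average F x : \bar R :=
  (fine (mu (oball dist d (f x))))^-1%:E * \int[mu]_(z in oball dist d (f x)) F z.

Lemma mu_fin_num A : measurable A -> mu A \is a fin_num.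
Proof.
move=> mA; rewrite ge0_fin_numE//.
by apply: le_lt_trans mu_fin; apply: le_measure; rewrite ?inE.
Qed.

Lemma fine_mu_ball_gt0 x : (0 < fine (mu (oball dist d x)))%R.
Proof.
by rewrite fine_gt0// ball_pos/= ltey_eq mu_fin_num.
Qed.

Lemma ball_average_ge0 F x : (forall z, 0 <= F z) -> 0 <= ball_average F x.
Proof.
move=> F0; apply: mule_ge0.
  by rewrite lee_fin invr_ge0 ltW// fine_mu_ball_gt0.
exact: integral_ge0.
Qed.

Lemma le_ball_average F G x : (forall z, 0 <= F z) -> (forall z, F z <= G z) ->
  ball_average F x <= ball_average G x.
Proof.
move=> F0 FG; rewrite lee_pmul2l// ?lte_fin ?invr_gt0 ?fine_mu_ball_gt0//.
exact: ge0_le_integral_nonmeasurable.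
Qed.

Lemma ball_averageZ_ge F c x : (0 <= c)%R -> (forall z, 0 <= F z) ->
  c%:E * ball_average F x <= ball_average (fun z => c%:E * F z) x.
Proof.
move=> c0 F0; rewrite /ball_average muleCA.
rewrite lee_pmul2l// ?lte_fin ?invr_gt0 ?fine_mu_ball_gt0//.
exact: ge0_integralZ_ge.
Qed.

Lemma ball_average1 x : ball_average (fun=> 1) x = 1.
Proof.
rewrite /ball_average integral_cst// mul1e.
rewrite -[X in _ * X]fineK ?mu_fin_num// -EFinM mulVf//.
by rewrite gt_eqF// fine_mu_ball_gt0.
Qed.

(** The ball has measure at most [mu [set: M]], whence a bound independent of [x]. *)
Lemma ball_average_indic_ge B x : measurable B -> B `<=` oball dist d (f x) ->
  (fine (mu B) / fine (mu [set: M]))%:E <= ball_average (fun z => (\1_B z)%:E) x.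
Proof.
move=> mB Bball; rewrite /ball_average integral_indic//.
rewrite setIidl// -[X in _ * X]fineK ?mu_fin_num// -EFinM lee_fin mulrC.
rewrite ler_wpM2r// ?fine_ge0// lef_pV2 ?posrE ?fine_mu_ball_gt0//.
  by rewrite fine_le// ?mu_fin_num// le_measure ?inE.
rewrite fine_gt0// -ge0_fin_numE// mu_fin_num// andbT.
by apply: lt_le_trans (ball_pos x) _; rewrite le_measure ?inE.
Qed.

Lemma fdd_cons A As x :
  fdd dist mu f d (A :: As) x = (\1_A x)%:E * ball_average (fdd dist mu f d As) x.
Proof. by []. Qed.

Lemma fdd_ge0 As x : 0 <= fdd dist mu f d As x.
Proof.
elim: As x => [|A As IHAs] x; first exact: lee01.
by rewrite fdd_cons mule_ge0// ?lee_fin// ball_average_ge0.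
Qed.

(** An inequality form of the Markov property: the factor [c], gained at the last state in [A], is
    pulled out through the successive averages by [ball_averageZ_ge]. *)
Lemma fdd_cat_ge As A Bs c x : (0 <= c)%R ->
  (forall y, A y -> c%:E <= ball_average (fdd dist mu f d Bs) y) ->
  c%:E * fdd dist mu f d (rcons As A) x <= fdd dist mu f d (rcons As A ++ Bs) x.
Proof.
move=> c0 AB; elim: As x => [|B As IHAs] x.
  rewrite /= -/(ball_average _ x) -/(ball_average _ x) ball_average1 mule1.
  rewrite indicE; case: (boolP (x \in A)) => [/set_mem Ax|_].
    by rewrite mule1 mul1e AB.
  by rewrite mule0 mul0e.
rewrite rcons_cons cat_cons !fdd_cons muleCA lee_wpmul2l ?lee_fin//.
apply: le_trans (ball_averageZ_ge _ _ _) _ => //; first exact: fdd_ge0.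
by apply: le_ball_average => // z; rewrite mule_ge0// fdd_ge0.
Qed.

(** From any point of a cell the next cell of the path fits in the current ball, so it is hit with
    probability at least [k]; these factors multiply. *)
Lemma path_average_ge (S : eqType) (cell : S -> set M) (step : rel S) (k : R) a s y :
  (0 <= k)%R -> (forall b, measurable (cell b)) ->
  (forall a b, step a b -> (k <= fine (mu (cell b)) / fine (mu [set: M]))%R /\
    forall y, cell a y -> cell b `<=` oball dist d (f y)) ->
  path step a s -> cell a y ->
  (k ^+ size s)%:E <= ball_average (fdd dist mu f d (map cell s)) y.
Proof.
move=> k0 mcell stepP; elim: s a y => [|b s IHs] a y.
  by rewrite [map _ _]/= ball_average1.
rewrite [path _ _ _]/= map_cons => /andP[/stepP[kb ball_b] /IHs{}IHs] /ball_b{}ball_b.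
have ks0 : (0 <= k ^+ size s)%R by rewrite exprn_ge0.
apply: (@le_trans _ _ (ball_average (fun z => (k ^+ size s)%:E * (\1_(cell b) z)%:E) y)).
  apply: le_trans (ball_averageZ_ge _ _ _) => //.
  rewrite exprS mulrC EFinM lee_wpmul2l ?lee_fin//.
  apply: le_trans (ball_average_indic_ge _ _) => //.
apply: le_ball_average => z.
  by rewrite mule_ge0// lee_fin.
rewrite fdd_cons muleC indicE; case: (boolP (z \in cell b)) => [/set_mem bz|_].
  by rewrite !mul1e IHs.
by rewrite !mul0e.
Qed.

End FiniteDimensionalLaws.

(** * A process with finitely many values, seen through its finite words *)

Section CodedProcess.
Context {R : realType} {dO : measure_display} {Om : measurableType dO}
  (P : probability Om R) {S : finType} (X : nat -> Om -> S).
Hypothesis mX : forall n a, measurable (X n @^-1` [set a]).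
Implicit Types (s : seq S) (w : Om) (D : pred (seq S)) (a : S).

Definition word n w : seq S := mkseq (X^~ w) n.

Definition cylinder s : set Om := [set w | word (size s) w = s].

Lemma take_word m n w : (m <= n)%N -> take m (word n w) = word m w.
Proof. by move=> mn; rewrite /word /mkseq -map_take take_iota (minn_idPl mn). Qed.

Lemma drop_word m n w :
  drop m (word (m + n) w) = [seq X i w | i <- iota m n].
Proof. by rewrite /word /mkseq -map_drop drop_iota addKn. Qed.

Lemma wordS n w : word n.+1 w = rcons (word n w) (X n w).
Proof. by rewrite /word mkseqS. Qed.

Lemma last_word a n w : last a (word n.+1 w) = X n w.
Proof. by rewrite wordS last_rcons. Qed.

Lemma measurable_cylinder s : measurable (cylinder s).
Proof.
elim/last_ind: s => [|s a IHs].
  by rewrite (_ : cylinder _ = setT)//; apply/seteqP; split.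
rewrite (_ : cylinder _ = cylinder s `&` X (size s) @^-1` [set a]).
  exact: measurableI.
apply/seteqP; split=> w; rewrite /cylinder/= size_rcons wordS.
  by move=> /rcons_inj[].
by move=> [-> ->].
Qed.

Lemma word_eventE D n : [set w | D (word n w)] =
  \bigcup_(t in [set t : n.-tuple S | D t]) cylinder t.
Proof.
apply/seteqP; split=> w /=.
  move=> Dw; have sw : size (word n w) == n by rewrite size_mkseq.
  by exists (Tuple sw) => //; rewrite /cylinder/= size_mkseq.
by move=> [t /= Dt]; rewrite /cylinder/= size_tuple => ->.
Qed.

Lemma cylinder_cat_sub s t : cylinder (s ++ t) `<=` cylinder s.
Proof.
move=> w; rewrite /cylinder/= size_cat => sE.
by rewrite -(take_word w (leq_addr (size t) (size s))) sE take_size_cat.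
Qed.

Lemma measurable_word_event D n : measurable [set w | D (word n w)].
Proof.
rewrite (word_eventE D n); apply: fin_bigcup_measurable => [|t _]; first exact: finite_finset.
exact: measurable_cylinder.
Qed.

Lemma trivIset_cylinder n (E : set (n.-tuple S)) : trivIset E (fun t => cylinder t).
Proof.
move=> t u _ _ [w []]; rewrite /cylinder/= !size_tuple => tw uw.
by apply: val_inj; rewrite /= -tw -uw.
Qed.

(** Each cylinder of length [n] loses at least the fraction [c] of its mass when its continuation by
    [q] is removed; the cylinders are disjoint, so the losses add up. *)
Lemma avoid_word_le D n (q : seq S -> seq S) (c : R) : 0 <= c <= 1 ->
  (forall s, size s = n -> D s ->
     (c%:E * P (cylinder s) <= P (cylinder (s ++ q s)))%E) ->
  (P [set w | D (word n w) /\ word (n + size (q (word n w))) w <> word n w ++ q (word n w)]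
   <= (1 - c)%:E * P [set w | D (word n w)])%E.
Proof.
move=> /andP[c0 c1] qc; set E := [set t : n.-tuple S | D t].
have finE : finite_set E by exact: finite_finset.
rewrite (_ : [set w | _ /\ _] =
    \bigcup_(t in E) (cylinder t `\` cylinder (t ++ q t))); last first.
  apply/seteqP; split=> w /=.
    move=> [Dw Nw]; have sw : size (word n w) == n by rewrite size_mkseq.
    exists (Tuple sw) => //; split; first by rewrite /cylinder/= size_mkseq.
    by rewrite /cylinder/= size_cat size_mkseq.
  move=> [t /= Dt []]; rewrite /cylinder/= size_cat size_tuple => ->.
  by [].
have mD t : measurable (cylinder t `\` cylinder (t ++ q t)).
  by apply: measurableD; exact: measurable_cylinder.
rewrite measure_fin_bigcup//; last first.
  move=> t u Et Eu [w [[tw _] [uw _]]].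
  by apply: (@trivIset_cylinder n E) => //; exists w.
rewrite (word_eventE D n) measure_fin_bigcup//; last 2 first.
- exact: trivIset_cylinder.
- by move=> t _; exact: measurable_cylinder.
rewrite ge0_mule_fsumr//; apply: lee_fsum => // t Et.
have mc s : measurable (cylinder s) by exact: measurable_cylinder.
have fc s : P (cylinder s) \is a fin_num by exact: fin_num_measure.
rewrite measureD//; last by rewrite ltey_eq fc.
rewrite setIidr; last exact: cylinder_cat_sub.
have scale (x y : \bar R) : x \is a fin_num -> y \is a fin_num ->
    (c%:E * x <= y -> x - y <= (1 - c)%:E * x)%E.
  by case: x y => [x| |] [y| |]// _ _; rewrite -EFinM -EFinB -EFinM !lee_fin; lra.
exact: scale (fc _) (fc _) (qc t (size_tuple t) Et).
Qed.

Variables (H : pred S) (q : S -> seq S) (n0 T : nat) (c : R).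
Hypothesis size_q : forall a, size (q a) = T.
Hypothesis c_bound : 0 < c <= 1.
Hypothesis q_prob : forall s a, H a ->
  (c%:E * P (cylinder (rcons s a)) <= P (cylinder (rcons s a ++ q a)))%E.

Lemma avoid_forever0 (E : set Om) : measurable E ->
  E `<=` [set w | forall k, H (X (n0 + k * T) w) /\
    [seq X i w | i <- iota (n0 + k * T).+1 T] <> q (X (n0 + k * T) w)] ->
  P E = 0%E.
Proof.
move=> mE Eavoid.
have [->|/set0P[w0 _]] := eqVneq E set0; first by rewrite measure0.
pose a0 := X 0%N w0.
(* [bad k] says that the first [k] blocks miss their words, as a boolean on finite words so that
   [B k] is measurable; [H] of the last letter lets [q_prob] apply to the next block. *)
pose fix bad (k : nat) (s : seq S) {struct k} : bool := if k is k'.+1 then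
    let s' := take (n0 + k' * T).+1 s in
    [&& bad k' s', s != s' ++ q (last a0 s') & H (last a0 s)]
  else H (last a0 s).
have badS k s : bad k.+1 s =
    [&& bad k (take (n0 + k * T).+1 s),
        s != take (n0 + k * T).+1 s ++ q (last a0 (take (n0 + k * T).+1 s))
      & H (last a0 s)] by [].
have bad0 s : bad 0%N s = H (last a0 s) by [].
pose B k := [set w | bad k (word (n0 + k * T).+1 w)].
have badH k s : bad k s -> H (last a0 s) by case: k => //= k /and3P[].
have nk k : (n0 + k.+1 * T).+1 = ((n0 + k * T).+1 + T)%N.
  by rewrite mulSn addnCA addnC.
have PB k : (P (B k) <= ((1 - c) ^+ k)%:E)%E.
  elim: k => [|k IHk].
    by rewrite expr0; apply: probability_le1; exact: measurable_word_event.
  have /andP[c0 c1] := c_bound.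
  rewrite exprS EFinM; apply: le_trans (lee_wpmul2l _ IHk); last first.
    by rewrite lee_fin subr_ge0.
  apply: le_trans (avoid_word_le (q := fun s => q (last a0 s)) _ _); last 2 first.
  - by rewrite ltW.
  - move=> s; case/lastP: s => // s a _ /badH.
    by rewrite last_rcons; exact: q_prob.
  apply: le_measure; rewrite ?inE.
  - exact: measurable_word_event.
  - move: (n0 + k * T).+1 => n.
    set F := [set w | _]; rewrite (_ : F = [set w | [pred s | bad k (take n s) &&
        (s != take n s ++ q (last a0 (take n s)))] (word (n + T) w)]).
      exact: measurable_word_event.
    apply/seteqP; split=> w; rewrite /F/= size_q take_word ?leq_addr//.
      by move=> [-> /eqP].
    by move=> /andP[-> /eqP].
  - move=> w; rewrite /B /mkset nk badS take_word ?leq_addr// size_q.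
    by move=> /and3P[? /eqP].
have EB k : E `<=` B k.
  move=> w /Eavoid/= wE; elim: k => [|k IHk].
    by rewrite /B/mkset bad0 last_word; have [] := wE 0%N; rewrite mul0n.
  rewrite /B/mkset badS nk take_word ?leq_addr// -nk !last_word (wE _).1 andbT.
  apply/andP; split; first exact: IHk.
  apply/eqP => /(congr1 (drop (n0 + k * T).+1)).
  rewrite nk drop_word drop_size_cat ?size_mkseq//.
  exact: (wE k).2.
have mB k : measurable (B k) by exact: measurable_word_event.
have fE : P E \is a fin_num by exact: fin_num_measure.
apply/eqP; rewrite eq_le measure_ge0 andbT -(fineK fE) lee_fin.
have /andP[c0 c1] := c_bound.
have lim0 : (fun k => (1 - c) ^+ k) @ \oo --> (0 : R).
  by apply: cvg_expr; rewrite ger0_norm; lra.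
rewrite -(cvg_lim _ lim0)//; apply: limr_ge; first by apply/cvg_ex; exists 0.
apply: nearW => k; rewrite -lee_fin fineK//; apply: le_trans (PB k).
by apply: le_measure; rewrite ?inE.
Qed.

End CodedProcess.

(** * Measurability of shadowing, and a finite measurable coding of the space *)

Section Measurability.
Context {R : realType} {disp : measure_display} {M : measurableType disp}
  {dist : M -> M -> R}.
Hypothesis dist_metric : is_metric dist.
Hypothesis M_compact : dcompact dist [set: M].
Hypothesis borelE : @measurable disp M = <<s dopen dist >>.
Context {dO : measure_display} {Om : measurableType dO}.

Lemma measurable_dopen (A : set M) : dopen dist A -> measurable A.
Proof. by move=> Ao; rewrite borelE; exact: sub_sigma_algebra. Qed.

(** The inequality holds iff at every scale [1/(k+1)] some point of a finite net is that close to
    [g w] and within [r + 1/(k+1)] of [h w]; this involves only preimages of balls. *)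
Lemma measurable_dist_le (g h : Om -> M) (r : R) :
  (forall A, dopen dist A -> measurable (g @^-1` A)) ->
  (forall A, dopen dist A -> measurable (h @^-1` A)) ->
  measurable [set w | dist (g w) (h w) <= r].
Proof.
move=> mg mh.
have net k : exists s : seq M, forall x, exists2 z, z \in s & dist z x < k.+1%:R^-1.
  by apply: finite_net => //; rewrite invr_gt0 ltr0n.
have {net}[net netP] := choice net.
rewrite (_ : [set w | _] = \bigcap_k \bigcup_(z in [set` net k])
    (g @^-1` oball dist k.+1%:R^-1 z `&` h @^-1` oball dist (r + k.+1%:R^-1) z)).
  apply: bigcapT_measurable => k; apply: fin_bigcup_measurable => // z _.
  by apply: measurableI; [apply: mg|apply: mh]; exact: dopen_oball.
apply/seteqP; split=> w /= H.
  move=> k _; have [z zk zg] := netP k (g w); exists z => //; split=> //=.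
  rewrite /oball/=; have := dist_triangle dist_metric (g w) z (h w).
  by move: (k.+1%:R^-1) zg => i; lra.
rewrite leNgt; apply/negP => far.
have s0 : 0 < (dist (g w) (h w) - r) / 2 by lra.
have [k /(_ k (leqnn k)) kP] := ltr_invSn s0.
have [z zk []] := H k I; rewrite /oball/=.
have := dist_triangle dist_metric z (g w) (h w).
rewrite (distC dist_metric (g w) z).
by move: (k.+1%:R^-1) kP => i; lra.
Qed.

(** The quantifier over shadowing points becomes countable: for every [m], some net point shadows up
    to time [m] with slack [1/(m+1)]. A true shadowing point is recovered by
    [shadowed_of_finite]. *)
Lemma measurable_shadowed (f : M -> M) (eps : R) (Y : nat -> Om -> M) :
  dcontinuous dist f -> (forall n, measurable_fun [set: Om] (Y n)) ->
  measurable [set w | shadowed dist f eps (fun n => Y n w)].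
Proof.
move=> fc mY.
have mYo n A : dopen dist A -> measurable (Y n @^-1` A).
  by move=> /measurable_dopen mA; rewrite -[X in measurable X]setTI; exact: mY.
have net k : exists s : seq M, forall x, exists2 z, z \in s & dist z x < k.+1%:R^-1.
  by apply: finite_net => //; rewrite invr_gt0 ltr0n.
have {net}[net netP] := choice net.
rewrite (_ : [set w | _] = \bigcap_m \bigcup_k \bigcup_(z in [set` net k])
    \bigcap_(n in `I_m.+1) [set w | dist (Y n w) (iter n f z) <= eps + m.+1%:R^-1]).
  apply: bigcapT_measurable => m; apply: bigcupT_measurable => k.
  apply: fin_bigcup_measurable => // z _; apply: fin_bigcap_measurable => // n _.
  apply: measurable_dist_le; first exact: mYo.
  by move=> A _; rewrite preimage_cst; case: ifP.
apply/seteqP; split=> w /=.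
  move=> [x xP] m _; have m0 : 0 < m.+1%:R^-1 :> R by rewrite invr_gt0 ltr0n.
  have [r r0 fr] := iter_near x m fc m0.
  have [k /(_ k (leqnn k)) kP] := ltr_invSn r0.
  have [z zk zx] := netP k x; exists k => //; exists z => // n /= nm.
  rewrite ltnS in nm.
  have := fr z; rewrite (distC dist_metric x) => /(_ (lt_trans zx kP) n nm).
  have := dist_triangle dist_metric (iter n f x) (Y n w) (iter n f z).
  by have := xP n; move: (m.+1%:R^-1) => i; lra.
move=> H; apply: shadowed_of_finite => // m.
have [k _ [z _ zP]] := H m I; exists z => n nm.
by apply: zP; rewrite /= ltnS.
Qed.

Lemma measurable_shadow_event (f : M -> M) (y0 : M) (d eps : R) (Y : nat -> Om -> M) :
  dcontinuous dist f -> (forall n, measurable_fun [set: Om] (Y n)) ->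
  measurable (shadow_event dist f y0 d eps Y).
Proof.
move=> fc mY.
have mYo n A : dopen dist A -> measurable (Y n @^-1` A).
  by move=> /measurable_dopen mA; rewrite -[X in measurable X]setTI; exact: mY.
rewrite (_ : shadow_event _ _ _ _ _ _ = [set w | dist (Y 0%N w) y0 <= 0] `&`
    (\bigcap_n [set w | dist (Y n.+1 w) (f (Y n w)) <= d]) `&`
    [set w | shadowed dist f eps (fun n => Y n w)]).
  apply: measurableI; last exact: measurable_shadowed.
  apply: measurableI.
    apply: measurable_dist_le; first exact: mYo.
    by move=> A _; rewrite preimage_cst; case: ifP.
  apply: bigcapT_measurable => n; apply: measurable_dist_le; first exact: mYo.
  by move=> A /(dopen_preimage fc); exact: (mYo n).
apply/seteqP; split=> w.
  by move=> [<- yP ?]; split=> //; split=> [|n _]; rewrite /= ?dist_self//; exact: yP.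
move=> [[/= y0P yP] ?]; split=> //; last by move=> n; exact: yP.
case: dist_metric => /(_ (Y 0%N w) y0)[+ _] _ _; apply.
by apply/eqP; rewrite eq_le y0P dist_ge0.
Qed.

(** The code of a point records which balls of radius [e / 2] about a finite net contain it; points
    with the same code share such a ball. *)
Lemma finite_coding (e : R) : 0 < e -> exists (S : finType) (code : M -> S),
  (forall b, measurable (code @^-1` [set b])) /\
  forall x z, code x = code z -> dist x z < e.
Proof.
move=> e0; have e20 : 0 < e / 2 by lra.
have [s sP] := finite_net dist_metric M_compact e20.
exists {ffun 'I_(size s) -> bool}.
exists (fun x => [ffun i => dist (tnth (in_tuple s) i) x < e / 2]); split=> [b|x z].
  rewrite (_ : _ @^-1` _ = \bigcap_(i in [set: 'I_(size s)])
      (if b i then oball dist (e / 2) (tnth (in_tuple s) i)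
       else ~` oball dist (e / 2) (tnth (in_tuple s) i))).
    apply: fin_bigcap_measurable => // i _.
    have mo : measurable (oball dist (e / 2) (tnth (in_tuple s) i)).
      exact/measurable_dopen/dopen_oball.
    by case: ifP => // _; exact: measurableC.
  apply/seteqP; split=> x /=.
    by move=> <- i _; rewrite ffunE /oball; case: ifP => //= /negP.
  move=> xb; apply/ffunP => i; rewrite ffunE; have := xb i I; rewrite /oball.
  by case: (b i) => //= /negP/negbTE.
have [p ps px] := sP x; have [i si pE] := nthP x ps.
move=> /ffunP/(_ (Ordinal si)); rewrite !ffunE (tnth_nth x)/= pE px => /esym pz.
by have := dist_triangle dist_metric p x z; rewrite (distC dist_metric x p); lra.
Qed.

End Measurability.

(** * Cells of positive measure, and the conclusion *)

Lemma finite_pos_bound (R : realType) (S : finType) (F : S -> R) :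
  exists2 k : R, 0 < k <= 1 & forall b, 0 < F b -> k <= F b.
Proof.
suff [k k01 kF] : exists2 k : R, 0 < k <= 1 & forall b, b \in enum S -> 0 < F b -> k <= F b.
  by exists k => // b; apply: kF; rewrite mem_enum.
elim: (enum S) => [|a s [k /andP[k0 k1] kF]]; first by exists 1; rewrite ?ltr01 ?lexx.
have [Fa|Fa] := ltP 0 (F a); last first.
  exists k => [|b]; first by rewrite k0.
  by rewrite inE => /predU1P[->|/kF//]; rewrite ltNge Fa.
exists (Num.min k (F a)); first by rewrite lt_min k0 Fa ge_min k1.
move=> b; rewrite inE ge_min => /predU1P[->|/kF H /H ->//].
by rewrite lexx orbT.
Qed.

(** The finitely many cells meeting [A] cover it, so they cannot all be null. *)
Lemma positive_cell (R : realType) (disp : measure_display) (M : measurableType disp)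
  (mu : {measure set M -> \bar R}) (S : finType) (code : M -> S) (A : set M) :
  (forall b, measurable (code @^-1` [set b])) -> measurable A -> (0 < mu A)%E ->
  exists2 b, (0 < mu (code @^-1` [set b]))%E & exists2 x, A x & code x = b.
Proof.
move=> mcode mA Apos; apply: contrapT => /forall2NP H.
suff : (mu A <= 0)%E by rewrite leNgt Apos.
pose D := [set b | exists2 x, A x & code x = b].
have finD : finite_set D by exact: finite_finset.
apply: (@le_trans _ _ (mu (\bigcup_(b in D) code @^-1` [set b]))).
  apply: le_measure; rewrite ?inE//.
    by apply: fin_bigcup_measurable => // b _; exact: mcode.
  by move=> x Ax; exists (code x) => //; exists x.
rewrite measure_fin_bigcup//; last by move=> a b _ _ [x [/= <- <-]].
rewrite fsbig1// => b Db; apply/eqP; rewrite eq_le measure_ge0 andbT leNgt.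
by apply/negP => bpos; case: (H b).
Qed.

Theorem theorem2 (R : realType) (disp : measure_display) (M : measurableType disp)
  (dist : M -> M -> R) (mu : {measure set M -> \bar R}) (f : M -> M) (L : set M) :
  is_metric dist ->
  dcompact dist [set: M] ->
  @measurable disp M = <<s dopen dist >> ->
  (mu [set: M] < +oo)%E ->
  (forall U : set M, dopen dist U -> U !=set0 -> (0 < mu U)%E) ->
  homeomorphism dist f ->
  attractor dist f L ->
  transitive_set dist f L ->
  ~ shadowing_on dist f L ->
  exists2 eps0 : R, 0 < eps0 &
    forall y0 : M, domain_of_attraction dist f L y0 ->
      exists2 d0 : R, 0 < d0 &
        forall d : R, 0 < d -> d < d0 ->
          forall (dO : measure_display) (Om : measurableType dO)
                 (P : probability Om R) (Y : nat -> Om -> M),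
            random_pseudotraj dist mu f y0 d P Y ->
            measurable (shadow_event dist f y0 d eps0 Y) /\
            P (shadow_event dist f y0 d eps0 Y) = 0%E.
Proof.
move=> dm Mc borelE mu_fin mu_pos [g [fK gK fc gc]].
move=> [_ fL [U [Uo LU _ UL]]] Ltrans noshad.
(* [L] is closed, being an orbit closure. *)
have Lcl : dclosure dist L `<=` L.
  have [r _ LE] := Ltrans => x Lx; rewrite LE => e e0.
  have e20 : 0 < e / 2 by lra.
  have [l] := Lx _ e20; rewrite LE => /(_ _ e20)[s Ss ls] xl; exists s => //.
  by have := dist_triangle dm l x s; lra.
have [e e0 eU] := nbhd_of_sub_open dm Mc Lcl Uo LU.
pose e1 := e / 2; have e1_gt0 : 0 < e1 by rewrite divr_gt0.
have e1U : nbhd_of dist (e1 + e1) L `<=` U by rewrite /e1 -splitr.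
have /existsNP[eps /not_implyP[eps_gt0 /forall2NP nodelta]] := noshad.
exists (eps / 2); first by rewrite divr_gt0.
move=> y0 /(eventually_trapped dm Mc fK gK fc gc fL UL e1_gt0 e1U)
  [n0 [d0 d0_gt0 trap]].
exists d0 => // d d_gt0 d_lt dO Om P Y [mY fddY].
have mE : measurable (shadow_event dist f y0 d (eps / 2) Y).
  exact: measurable_shadow_event.
split=> //.
have d4 : 0 < d / 4%:R by lra.
have [s s_gt0 fs] := uniform_continuity dm Mc fc d4.
(* Error budget: [2 del <= s] keeps images within [d / 4], so one coded step costs less than
   [d / 4 + d / 8 + d / 4 < d]; and [2 del + eps / 2 <= eps] serves in the final comparison. *)
pose del := Num.min (s / 2%:R) (Num.min (d / 8%:R) (eps / 4%:R)).
have del_gt0 : 0 < del by rewrite !lt_min; apply/and3P; split; lra.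
have del_s : del <= s / 2%:R by rewrite ge_min lexx.
have del_d : del <= d / 8%:R by rewrite !ge_min lexx orbT.
have del_eps : del <= eps / 4%:R by rewrite !ge_min lexx !orbT.
clearbody del.
have [w [Lw wP wns]] : exists w : nat -> M, [/\ forall n, L (w n),
    pseudotraj dist f del w & ~ shadowed dist f eps w].
  have [/negP|] := nodelta del; first by rewrite del_gt0.
  by move=> /existsNP[w /not_implyP[Lw /not_implyP[wP wns]]]; exists w.
(* By compactness, a single time [N] witnesses the failure of shadowing for all points [x]. *)
have [N wN] : exists N, forall x, exists2 n, (n <= N)%N & eps < dist (w n) (iter n f x).
  apply: contrapT => /forallNP H; apply: wns; apply: shadowed_of_finite => // m.
  have /existsNP[x /forall2NP xP] := H m; exists x => n nm.
  have [//|/negP] := xP n; rewrite -leNgt => wx.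
  by apply: le_trans wx _; rewrite lerDl invr_ge0 ler0n.
have [S [code [mcode codeP]]] := finite_coding dm Mc borelE del_gt0.
pose cell b := code @^-1` [set b].
have m_ball r x : measurable (oball dist r x).
  by apply: (measurable_dopen borelE); exact: dopen_oball.
have ball_pos r x : 0 < r -> (0 < mu (oball dist r x))%E.
  move=> r0; apply: mu_pos; first exact: dopen_oball.
  by exists x; rewrite /oball/= dist_self.
(* The cell of [z] itself may be null, so a cell of positive measure meeting the ball of radius
   [del] about [z] replaces it. *)
have near_ex z : exists b, (0 < mu (cell b))%E /\
    forall u, code u = b -> dist z u < del + del.
  have [b bpos [x zx xb]] := positive_cell mcode (m_ball del z) (ball_pos _ z del_gt0).
  exists b; split=> // u ub; move: zx; rewrite /oball/=.
  have := codeP x u; rewrite xb ub => /(_ erefl).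
  by have := dist_triangle dm x z u; lra.
have [near nearP] := choice near_ex.
have [k /andP[k0 k1] kP] :=
  finite_pos_bound (fun b => fine (mu (cell b)) / fine (mu [set: M])).
pose step a b := `[< k <= fine (mu (cell b)) / fine (mu [set: M]) /\
    forall y, cell a y -> cell b `<=` oball dist d (f y) >].
(* Being trapped near [L], stated for the cell alone so that the continuation can be chosen as a
   function of the cell. *)
pose H a := `[< exists2 x, code x = a & forall n, nbhd_of dist e1 L (iter n f x) >].
(* The pair is a pseudotrajectory issued from the cell [a] and the time when it reaches [w 0];
   outside [H] it is arbitrary. *)
have pt_ex a : exists p : (nat -> M) * nat, H a ->
    [/\ pseudotraj dist f del p.1, code (p.1 0%N) = a, (0 < p.2)%N &
        forall i, p.1 (p.2 + i)%N = w i].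
  have [/asboolP[x xa xK]|nH] := boolP (H a); last by exists (w, 0%N) => Ha; case/negP: nH.
  have [T [z [T0 zP z0 zw]]] :=
    connecting dm Mc fK gK fc gc fL UL e1_gt0 e1U Ltrans del_gt0 xK wP (Lw 0%N).
  by exists (z, T) => _; split=> //=; rewrite z0.
have [pt ptP] := choice pt_ex.
(* One length for all cells, enough to reach [w 0] and go on to [w N]. *)
pose T := (\max_a (pt a).2 + N)%N.
(* Indices start at 1 because the chain already sits in the cell [a] at time 0 of the
   continuation. *)
pose q a := [seq near ((pt a).1 i) | i <- iota 1 T].
have size_q a : size (q a) = T by rewrite size_map size_iota.
pose X n := code \o Y n.
have mX n a : measurable (X n @^-1` [set a]).
  rewrite /X comp_preimage -[X in measurable X]setTI; apply: mY => //.
have PX t : P (cylinder X t) = fdd dist mu f d (map cell t) y0.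
  rewrite -fddY; last first.
    move=> i; rewrite size_map => it.
    by case: t it => // b t it; rewrite (nth_map b)//; exact: mcode.
  congr (P _); apply/seteqP; split=> v /=; rewrite /cylinder/= size_map.
    move=> vt i it; case: t vt it => // b t vt it; rewrite (nth_map b)// -vt.
    by rewrite nth_mkseq.
  move=> vt; case: t vt => // b t vt; apply: (@eq_from_nth _ b); rewrite size_mkseq// => i it.
  by rewrite nth_mkseq//; have := vt i it; rewrite (nth_map b).
have m_gt0 : 0 < fine (mu [set: M]).
  rewrite fine_gt0// mu_fin andbT; apply: lt_le_trans (ball_pos d y0 d_gt0) _.
  by apply: le_measure; rewrite ?inE.
have near_step z j b : pseudotraj dist f del z ->
    (forall u, code u = b -> dist (z j) u < del + del) -> step b (near (z j.+1)).
  move=> zP zb; apply/asboolP; split.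
    apply: kP; rewrite divr_gt0// fine_gt0// (nearP _).1/=.
    by rewrite ltey_eq mu_fin_num//; exact: mcode.
  move=> y yb u ub; rewrite /oball/=.
  have zu := (nearP (z j.+1)).2 u ub.
  have fzy : dist (f (z j)) (f y) < d / 4%:R by apply: fs; have := zb y yb; lra.
  have zj := zP j.
  have := dist_triangle dm (f (z j)) (f y) u.
  have := dist_triangle dm (z j.+1) (f (z j)) u.
  by rewrite (distC dm (f y) (f (z j))) (distC dm (f (z j)) (z j.+1)); lra.
have near_path z n j b : pseudotraj dist f del z ->
    (forall u, code u = b -> dist (z j) u < del + del) ->
    path step b [seq near (z i) | i <- iota j.+1 n].
  move=> zP; elim: n j b => //= n IHn j b zb.
  rewrite near_step//=; apply: IHn => u; exact: (nearP _).2.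
(* The constant is [k ^+ T]: a path of [T] coded steps, each of probability at least [k]. *)
apply: (@avoid_forever0 _ _ _ P S X mX H q n0 T (k ^+ T)) => //.
- by rewrite exprn_gt0//= exprn_ile1// ltW.
- move=> t a /ptP[zP za _ _]; rewrite !PX map_cat map_rcons.
  apply: fdd_cat_ge => //.
  + by move=> x; exact: ball_pos.
  + by rewrite exprn_ge0// ltW.
  move=> y ya; rewrite -(size_q a).
  apply: (@path_average_ge _ _ _ _ _ _ _ _ _ _ _ cell step k a) => //.
  + by move=> x; exact: ball_pos.
  + by rewrite ltW.
  + by move=> b b' /asboolP.
  + apply: near_path => // u ua; have := codeP _ _ (etrans za (esym ua)); lra.
move=> v [Yv0 Yv [x0 x0P]] i.
set t := (n0 + i * T)%N.
have Ha : H (X t v).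
  apply/asboolP; exists (Y t v) => // n.
  (* The sampled pseudotrajectory up to time [t], continued by the exact orbit of [Y t v]; [trap]
     places that orbit near [L]. *)
  pose yy j := if (j <= t)%N then Y j v else iter (j - t.+1).+1 f (Y t v).
  have yyP : pseudotraj dist f d0 yy.
    apply: (@pseudotraj_le _ _ _ _ d); first exact: ltW.
    apply: (@pseudotraj_cat _ _ _ f d (fun j => Y j v)
      (fun j => iter j.+1 f (Y t v))) => //.
      by move=> j; rewrite iterS dist_self// ltW.
    by rewrite /= dist_self// ltW.
  have n0t : (n0 <= t + n)%N by rewrite /t -addnA leq_addr.
  have := trap yy yyP Yv0 (t + n)%N n0t; rewrite /yy; case: n {n0t} => [|n]; first by rewrite !addn0 leqnn.
  by rewrite addnS ltnNge leq_addr/= subSS addKn.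
split=> // winE.
have [zP za z0 zw] := ptP _ Ha.
set a := X t v in winE Ha zP za z0 zw.
(* If the word [q a] is read, [Y] passes within [2 del] of [w 0], ..., [w N] in turn, so the orbit
   of [x0] from time [t + (pt a).2] on would stay [eps]-close to them, against [wN]. *)
have [n nN] := wN (iter (t + (pt a).2) f x0); rewrite ltNge => /negP; apply.
have Ta : ((pt a).2 + n <= T)%N by rewrite leq_add// leq_bigmax.
(* As [q a] starts at index 1, time [(pt a).2 + n] is its entry [((pt a).2 + n).-1]; positivity
   comes from [z0]. *)
have Tn : ((pt a).2 + n = ((pt a).2 + n).-1.+1)%N by rewrite prednK// addn_gt0 z0.
have cE : code (Y (t + ((pt a).2 + n))%N v) = near (w n).
  have := congr1 (fun l => nth a l ((pt a).2 + n).-1) winE.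
  rewrite !(nth_map 0%N) ?size_iota -?Tn// !nth_iota -?Tn//.
  by rewrite add1n addSn -addnS -Tn zw.
have := (nearP (w n)).2 _ cE.
have := x0P (t + ((pt a).2 + n))%N; rewrite addnA [X in iter X]addnC iterD.
by have := dist_triangle dm (Y (t + (pt a).2 + n)%N v) (w n) (iter n f (iter (t + (pt a).2) f x0)); lra.
Qed.
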